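(* Let $r\ge 2$, let $\mathcal F$ be a blowup-invariant nondegenerate family of $r$-graphs, and let $\mathfrak H$ be a hereditary class of $\mathcal F$-free $r$-graphs. If $\mathcal F$ is symmetrized-stable with respect to $\mathfrak H$ and vertex-extendable with respect to $\mathfrak H$, then $\mathcal F$ is degree-stable with respect to $\mathfrak H$.
   Context: An $r$-graph is a finite $r$-uniform hypergraph $\mathcal H$, identified with its edge set, with vertex set $V(\mathcal H)$; $|\mathcal H|$ is its number of edges, $\delta(\mathcal H)$ its minimum vertex degree (the degree of a vertex is the number of edges containing it), and $\mathcal H-v$ is obtained by deleting the vertex $v$ and all edges containing it. $\mathcal H$ is $\mathcal F$-free if it contains no member of $\mathcal F$ as a (not necessarily induced) subgraph; $\mathrm{ex}(n,\mathcal F)$ is the maximum number of edges of an $\mathcal F$-free $r$-graph on $n$ vertices; $\pi(\mathcal F)=\lim_{n\to\infty}\mathrm{ex}(n,\mathcal F)/\binom nr$; $\mathcal F$ is nondegenerate if $\pi(\mathcal F)>0$. Classes of $r$-graphs are understood to be closed under isomorphism; a class is hereditary if it is closed under taking induced subgraphs. Blowup-invariant: a homomorphism from $F$ to $\mathcal H$ is a map $\phi\colon V(F)\to V(\mathcal H)$ with $\phi(E)\in\mathcal H$ for all $E\in F$; $\mathcal F$ is blowup-invariant if whenever an $r$-graph $\mathcal H$ is $\mathcal F$-free, there is no homomorphism from any $F\in\mathcal F$ to $\mathcal H$. Symmetrized: two vertices $u,v$ of $\mathcal H$ are equivalent if $L_{\mathcal H}(u)=L_{\mathcal H}(v)$,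 where $L_{\mathcal H}(v)=\{A\in\binom{V(\mathcal H)}{r-1} : A\cup\{v\}\in\mathcal H\}$; $\mathcal H$ is symmetrized if any two non-equivalent vertices lie together in some edge of $\mathcal H$. Symmetrized-stable with respect to $\mathfrak H$: there exist $\epsilon>0$ and $N_0$ such that every symmetrized $\mathcal F$-free $r$-graph $\mathcal H$ on $n\ge N_0$ vertices with $|\mathcal H|\ge(\pi(\mathcal F)/r!-\epsilon)n^r$ is a subgraph of a member of $\mathfrak H$. Vertex-extendable with respect to $\mathfrak H$: there exist $\zeta>0$ and $N_0\in\mathbb N$ such that for every $\mathcal F$-free $r$-graph $\mathcal H$ on $n\ge N_0$ vertices with $\delta(\mathcal H)\ge(\pi(\mathcal F)/(r-1)!-\zeta)n^{r-1}$ the following holds: if $\mathcal H-v$ is a subgraph of a member of $\mathfrak H$ for some vertex $v\in V(\mathcal H)$, then $\mathcal H$ is a subgraph of a member of $\mathfrak H$. Degree-stable with respect to $\mathfrak H$: there exist $\epsilon>0$ and $N_0$ such that every $\mathcal F$-free $r$-graph $\mathcal H$ on $n\ge N_0$ vertices with $\delta(\mathcal H)\ge(\pi(\mathcal F)/(r-1)!-\epsilon)n^{r-1}$ is a subgraph of some member of $\mathfrak H$. *)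

(* Defs.v *)
From HB Require Import structures.
From mathcomp Require Import all_boot all_order all_algebra.
From mathcomp Require Import all_classical all_reals all_analysis.

Set Implicit Arguments.
Unset Strict Implicit.
Unset Printing Implicit Defensive.

Import Order.TTheory GRing.Theory Num.Theory numFieldNormedType.Exports.

Local Open Scope ring_scope.

Record rhypergraph (r : nat) (T : finType) := RHypergraph {
  edges :> {set {set T}};
  edges_uniform : [forall e in edges, #|e| == r]
}.

HB.instance Definition _ (r : nat) (T : finType) :=
  [isSub for @edges r T].
HB.instance Definition _ (r : nat) (T : finType) :=
  [Finite of rhypergraph r T by <:].

(* A collection of r-graphs with arbitrary finite vertex sets. It need not be
   closed under isomorphism: see [iso_closed]. *)
Definition rhypergraph_class (r : nat) := forall T : finType, rhypergraph r T -> Prop.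

Section OneGraph.
Variables (r : nat) (T : finType) (H : rhypergraph r T).

Definition degree (v : T) : nat := #|[set e in edges H | v \in e]|.

(* No degree exceeds the number of edges, so the default value is irrelevant
   as soon as there is a vertex. *)
Definition min_degree : nat := \big[minn/#|edges H|]_(v : T) degree v.

Definition link (v : T) : {set {set T}} :=
  [set A : {set T} | (#|A| == r.-1) && (v |: A \in edges H)].

Definition symmetrized : Prop :=
  forall u v : T, link u <> link v ->
    exists2 e : {set T}, e \in edges H & (u \in e) && (v \in e).

Definition induced_edges (S : {set T}) : {set {set {x : T | x \in S}}} :=
  [set e : {set {x : T | x \in S}} | [set val x | x in e] \in edges H].

Lemma induced_uniform (S : {set T}) :
  [forall e in induced_edges S, #|e| == r].
Proof.
apply/forall_inP => e; rewrite inE => eH.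
by rewrite -(card_imset _ val_inj) (forall_inP (edges_uniform H)).
Qed.

Definition induced (S : {set T}) : rhypergraph r {x : T | x \in S} :=
  RHypergraph (induced_uniform S).

Definition del_vertex (v : T) : rhypergraph r {x : T | x \in [set~ v]} :=
  induced [set~ v].

End OneGraph.

Section TwoGraphs.
Variables (r : nat) (T U : finType) (F : rhypergraph r T) (H : rhypergraph r U).

Definition is_hom (f : T -> U) : Prop :=
  forall e : {set T}, e \in edges F -> [set f x | x in e] \in edges H.

Definition is_iso (f : T -> U) : Prop :=
  bijective f /\
  forall e : {set T}, ([set f x | x in e] \in edges H) = (e \in edges F).

(* [H] contains a (not necessarily induced, not necessarily spanning) copy of
   [F]. *)
Definition subgraph : Prop := exists f : T -> U, injective f /\ is_hom f.

End TwoGraphs.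

Section Classes.
Variable r : nat.
Implicit Types FF HH : rhypergraph_class r.

Definition family_free FF (T : finType) (H : rhypergraph r T) : Prop :=
  forall (U : finType) (F : rhypergraph r U), FF U F -> ~ subgraph F H.

Definition sub_member HH (T : finType) (H : rhypergraph r T) : Prop :=
  exists (U : finType) (G : rhypergraph r U), HH U G /\ subgraph H G.

Definition iso_closed HH : Prop :=
  forall (T U : finType) (G : rhypergraph r T) (H : rhypergraph r U) (f : T -> U),
    is_iso G H f -> HH T G -> HH U H.

Definition hereditary HH : Prop :=
  forall (T : finType) (H : rhypergraph r T) (S : {set T}),
    HH T H -> HH _ (induced H S).

Definition blowup_invariant FF : Prop :=
  forall (T : finType) (H : rhypergraph r T), family_free FF H ->
  forall (U : finType) (F : rhypergraph r U), FF U F ->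
  ~ exists f : U -> T, is_hom F H f.

Definition turan_number (n : nat) FF : nat :=
  \max_(H : rhypergraph r 'I_n | `[< family_free FF H >]) #|edges H|.

Definition turan_density (R : realType) FF : R :=
  limn (fun n : nat => (turan_number n FF)%:R / 'C(n, r)%:R : R).

Definition nondegenerate_family (R : realType) FF : Prop :=
  0 < turan_density R FF.

Definition symmetrized_stable (R : realType) FF HH : Prop :=
  exists (eps : R) (N0 : nat), 0 < eps /\
  forall (T : finType) (H : rhypergraph r T),
    symmetrized H -> family_free FF H -> (N0 <= #|T|)%N ->
    (turan_density R FF / r`!%:R - eps) * #|T|%:R ^+ r <= #|edges H|%:R ->
    sub_member HH H.

Definition vertex_extendable (R : realType) FF HH : Prop :=
  exists (zeta : R) (N0 : nat), 0 < zeta /\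
  forall (T : finType) (H : rhypergraph r T),
    family_free FF H -> (N0 <= #|T|)%N ->
    (turan_density R FF / (r.-1)`!%:R - zeta) * #|T|%:R ^+ r.-1
      <= (min_degree H)%:R ->
    (exists v : T, sub_member HH (del_vertex H v)) ->
    sub_member HH H.

Definition degree_stable (R : realType) FF HH : Prop :=
  exists (eps : R) (N0 : nat), 0 < eps /\
  forall (T : finType) (H : rhypergraph r T),
    family_free FF H -> (N0 <= #|T|)%N ->
    (turan_density R FF / (r.-1)`!%:R - eps) * #|T|%:R ^+ r.-1
      <= (min_degree H)%:R ->
    sub_member HH H.

End Classes.

(* Main.v *)
(** Call a vertex low if its degree is below [(c - k) n^(r-1)], where
    [c = pi / (r-1)!].  In an almost extremal free [r]-graph [H] there are few
    low vertices, as deleting them would leave too dense a graph.  The claim is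
    that [H] minus its low vertices lies below a member of the class; if the
    minimum degree of [H] is large then no vertex is low.

    Take a counterexample on a given vertex set with the most edges and, among
    those, the most ordered pairs of vertices with equal links.  It is not
    symmetrized, so it has nonadjacent [u], [v] with different links, [v] being
    the one of smaller degree (on ties, of smaller link class).  Turning [v]
    into a clone of [u] keeps the graph free and increases the measure, so the
    claim holds for the new graph [G].  As [G] and [H] agree away from [v], the
    graph [H] minus [v] and the low vertices of [G] and [H] lies below a
    member, and the few removed vertices that are not low in [H] can be put
    back one at a time by vertex-extendability. *)

Require Import Defs.
From mathcomp Require Import all_boot all_order all_algebra.
From mathcomp Require Import all_classical all_reals all_analysis.
From mathcomp Require Import ring lra zify.
(* mathcomp-analysis shadows names of these three files. *)
From mathcomp Require Import fintype finset.
Import Defs.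

Set Implicit Arguments.
Unset Strict Implicit.
Unset Printing Implicit Defensive.

Import Order.TTheory GRing.Theory Num.Theory numFieldNormedType.Exports.

Local Open Scope ring_scope.

(** * Homomorphisms, subgraphs and induced subgraphs *)

Lemma edge_card (r : nat) (T : finType) (H : rhypergraph r T) (e : {set T}) :
  e \in edges H -> #|e| = r.
Proof. by move=> eH; apply/eqP; exact: (forall_inP (edges_uniform H) e eH). Qed.

Lemma hom_comp (r : nat) (T U V : finType) (F : rhypergraph r T)
    (G : rhypergraph r U) (H : rhypergraph r V) (f : T -> U) (g : U -> V) :
  is_hom F G f -> is_hom G H g -> is_hom F H (g \o f).
Proof. by move=> fP gP e /fP /gP; rewrite -imset_comp. Qed.

Lemma subgraph_trans (r : nat) (T U V : finType) (F : rhypergraph r T)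
    (G : rhypergraph r U) (H : rhypergraph r V) :
  subgraph F G -> subgraph G H -> subgraph F H.
Proof.
move=> [f [fI fP]] [g [gI gP]]; exists (g \o f); split; first exact: inj_comp.
exact: hom_comp fP gP.
Qed.

Lemma sub_member_subgraph (r : nat) (HH : rhypergraph_class r) (T U : finType)
    (G : rhypergraph r T) (H : rhypergraph r U) :
  subgraph G H -> sub_member HH H -> sub_member HH G.
Proof.
move=> GH [V [K [KH HK]]]; exists V, K; split => //.
exact: subgraph_trans GH HK.
Qed.

Lemma family_free_subgraph (r : nat) (FF : rhypergraph_class r) (T U : finType)
    (G : rhypergraph r T) (H : rhypergraph r U) :
  subgraph G H -> family_free FF H -> family_free FF G.
Proof. by move=> GH HF V F FV FG; apply: HF FV (subgraph_trans FG GH). Qed.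

Lemma induced_subgraph (r : nat) (T : finType) (H : rhypergraph r T)
    (S : {set T}) : subgraph (induced H S) H.
Proof. by exists val; split; [exact: val_inj | move=> e; rewrite inE]. Qed.

Lemma subgraph_induced (r : nat) (T U : finType) (G : rhypergraph r T)
    (H : rhypergraph r U) (S : {set U}) (f : T -> U) :
  injective f -> is_hom G H f -> (forall x, f x \in S) ->
  subgraph G (induced H S).
Proof.
move=> fI fP fS; exists (fun x => exist _ (f x) (fS x)); split.
  by move=> x y /(congr1 val) /fI.
move=> e /fP; rewrite inE -imset_comp.
by congr (_ \in edges H); apply: eq_imset.
Qed.

Lemma induced_sub (r : nat) (T : finType) (G H : rhypergraph r T)
    (A B : {set T}) :
  A \subset B ->
  (forall e : {set T}, e \subset A -> e \in edges G -> e \in edges H) ->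
  subgraph (induced G A) (induced H B).
Proof.
move=> AB GH; apply: (subgraph_induced (f := val)); first exact: val_inj.
- move=> e; rewrite inE; apply: GH.
  by apply/subsetP => _ /imsetP[x _ ->]; exact: valP.
- by move=> x; apply: (subsetP AB); exact: valP.
Qed.

Lemma del_vertex_induced (r : nat) (T : finType) (H : rhypergraph r T)
    (S : {set T}) (v : {x : T | x \in S}) :
  subgraph (del_vertex (induced H S) v) (induced H (S :\ val v)).
Proof.
apply: (subgraph_induced (f := fun x => val (val x))).
- by move=> x y /val_inj /val_inj.
- by move=> e; rewrite !inE -imset_comp.
- move=> x; rewrite in_setD1 (valP (val x)) andbT.
  by have := valP x; rewrite !inE; apply: contraNneq => /val_inj ->.
Qed.

(** * Counting edges and degrees *)

Lemma imset_val_preim (T : finType) (S : {set T}) (e : {set T}) :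
  e \subset S ->
  [set val x | x in [set x : {x : T | x \in S} | val x \in e]] = e.
Proof.
move=> eS; apply/setP => y; apply/imsetP/idP => [[x] | ye].
  by rewrite inE => xe ->.
by exists (exist _ y (subsetP eS y ye)); rewrite ?inE.
Qed.

Lemma card_induced (r : nat) (T : finType) (H : rhypergraph r T)
    (S : {set T}) :
  #|edges (induced H S)| = #|[set e in edges H | e \subset S]|.
Proof.
rewrite -(card_imset _ (imset_inj val_inj)); congr #|pred_of_set _|.
apply/setP => e; rewrite inE; apply/imsetP/andP => [[d] | [eH eS]].
  rewrite inE => dH ->; split => //.
  by apply/subsetP => _ /imsetP[x _ ->]; exact: valP.
by exists [set x | val x \in e]; rewrite ?inE imset_val_preim.
Qed.

Lemma degree_induced (r : nat) (T : finType) (H : rhypergraph r T)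
    (S : {set T}) (v : {x : T | x \in S}) :
  degree (induced H S) v =
  #|[set e in [set e in edges H | val v \in e] | e \subset S]|.
Proof.
rewrite /degree -(card_imset _ (imset_inj val_inj)); congr #|pred_of_set _|.
apply/setP => e; rewrite !inE; apply/imsetP/andP => [[d] | [/andP[eH ve] eS]].
  rewrite !inE => /andP[dH vd] ->; rewrite dH mem_imset; last exact: val_inj.
  rewrite vd; split=> //.
  by apply/subsetP => _ /imsetP[x _ ->]; exact: valP.
by exists [set x | val x \in e]; rewrite ?inE ?imset_val_preim ?eH.
Qed.

Lemma card_setId (T : finType) (A : {set T}) (P : pred T) :
  #|[set x in A | P x]| = (\sum_(x in A) P x)%N.
Proof.
rewrite -sum1_card (eq_bigl (fun x => (x \in A) && P x)); last first.
  by move=> x; rewrite inE.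
by rewrite big_mkcondr; apply: eq_bigr => x _; case: (P x).
Qed.

(** An edge not inside [S] is counted at some vertex outside [S]. The set [E] is arbitrary because
    it is later both the full edge set and the set of edges through one vertex. *)
Lemma union_bound (T : finType) (E : {set {set T}}) (S : {set T}) :
  (#|E| <= #|[set e in E | e \subset S]|
           + \sum_(w in ~: S) #|[set e in E | w \in e]|)%N.
Proof.
rewrite card_setId; under [X in (_ <= _ + X)%N]eq_bigr do rewrite card_setId.
rewrite exchange_big -big_split -sum1_card /=.
apply: leq_sum => e _; case: (boolP (e \subset S)) => // /subsetPn[w we wS].
by rewrite add0n (bigD1 w) /= ?inE // we.
Qed.

Lemma ffact_leq_exp (n k : nat) : (n ^_ k <= n ^ k)%N.
Proof.
by elim: k => // k IH; rewrite ffactnSr expnSr leq_mul // leq_subr.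
Qed.

Lemma card_draws_leq (T : finType) (k : nat) :
  (#|[set A : {set T} | #|A| == k]| <= #|T| ^ k)%N.
Proof.
rewrite card_draws; apply: leq_trans (leq_pmulr _ (fact_gt0 k)) _.
by rewrite bin_ffact ffact_leq_exp.
Qed.

(** The map sending [e] to [e :\: A] is injective on these edges, and its values have size
    [r - #|A|]. *)
Lemma codegree_leq (r : nat) (T : finType) (H : rhypergraph r T)
    (A : {set T}) :
  (#|[set e in edges H | A \subset e]| <= #|T| ^ (r - #|A|))%N.
Proof.
apply: leq_trans (card_draws_leq T _).
rewrite -(@card_in_imset _ _ (fun e => e :\: A) [set e in edges H | _]);
  last first.
  move=> e d; rewrite !inE => /andP[_ Ae] /andP[_ Ad] ed.
  by rewrite -(setID e A) -(setID d A) ed (setIidPr Ae) (setIidPr Ad).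
apply: subset_leq_card; apply/subsetP => _ /imsetP[e + ->].
by rewrite !inE => /andP[eH Ae]; rewrite cardsDS // (edge_card eH).
Qed.

Lemma sum_degree (r : nat) (T : finType) (H : rhypergraph r T) :
  (\sum_(v : T) degree H v = #|edges H| * r)%N.
Proof.
rewrite -sum_nat_const /degree.
under eq_bigr do rewrite card_setId.
rewrite exchange_big /=; apply: eq_bigr => e eH.
rewrite -(edge_card eH) -sum1_card [RHS]big_mkcond.
by apply: eq_bigr => v _; case: (v \in e).
Qed.

(** An edge lost at [v] also contains some [w] outside [S], and each such pair lies in at most
    [#|T| ^ (r - 2)] edges by [codegree_leq]. *)
Lemma degree_induced_geq (r : nat) (T : finType) (H : rhypergraph r T)
    (S : {set T}) (v : {x : T | x \in S}) :
  (degree H (val v) <= degree (induced H S) v + #|~: S| * #|T| ^ (r - 2))%N.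
Proof.
rewrite degree_induced; apply: leq_trans (union_bound _ S) _.
rewrite leq_add2l -sum_nat_const; apply: leq_sum => w wS.
have vw : val v != w by apply: contraTneq wS => <-; rewrite inE negbK (valP v).
have <- : #|[set val v; w]| = 2%N by rewrite cards2 vw.
apply: leq_trans (codegree_leq H _); apply: subset_leq_card.
by apply/subsetP => e; rewrite !inE subUset !sub1set => /andP[/andP[-> ->] ->].
Qed.

Lemma min_degree_leq (r : nat) (T : finType) (H : rhypergraph r T) (v : T) :
  (min_degree H <= degree H v)%N.
Proof.
rewrite /min_degree; have := mem_index_enum v.
elim: (index_enum T) => // x s IH; rewrite inE big_cons geq_min.
by case/predU1P => [<- | /IH ->]; rewrite ?leqnn ?orbT.
Qed.

Lemma min_degree_geq (R : realType) (r : nat) (T : finType)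
    (H : rhypergraph r T) (v : T) (d : R) :
  (forall x : T, d <= (degree H x)%:R) -> d <= (min_degree H)%:R.
Proof.
move=> dP; rewrite /min_degree.
apply: (big_ind (fun m : nat => d <= m%:R)) => [|x y dx dy|x _]; last exact: dP.
(* The default of the minimum, [#|edges H|], is at least the degree of the given [v]. *)
- apply: le_trans (dP v) _; rewrite ler_nat; apply: subset_leq_card.
  by apply/subsetP => e; rewrite inE => /andP[].
- by rewrite /minn; case: ifP.
Qed.

(** * Blowups as pullbacks *)

Definition pullback_edges (r : nat) (T U : finType) (H : rhypergraph r U)
    (f : T -> U) : {set {set T}} :=
  [set e : {set T} | (#|e| == r) && ([set f x | x in e] \in edges H)].

Lemma pullback_uniform (r : nat) (T U : finType) (H : rhypergraph r U)
    (f : T -> U) : [forall e in pullback_edges H f, #|e| == r].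
Proof. by apply/forall_inP => e; rewrite inE => /andP[]. Qed.

(** This is the blowup of [H] that replaces each vertex by its fibre under [f], possibly empty. *)
Definition pullback (r : nat) (T U : finType) (H : rhypergraph r U)
    (f : T -> U) : rhypergraph r T :=
  RHypergraph (pullback_uniform H f).

(** Since [f] is a homomorphism to [H], a copy of a member in the pullback would yield a
    homomorphism from that member to [H]. *)
Lemma family_free_pullback (r : nat) (FF : rhypergraph_class r) (T U : finType)
    (H : rhypergraph r U) (f : T -> U) :
  blowup_invariant FF -> family_free FF H -> family_free FF (pullback H f).
Proof.
move=> FFb HF V F FV [g [_ gP]]; apply: (FFb _ _ HF _ _ FV).
exists (f \o g); apply: hom_comp gP _.
by move=> e; rewrite inE => /andP[].
Qed.

(* Links behave well under pullback because an edge of the pullback is mapped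
   injectively: its image is again an [r]-set. *)
Lemma link_pullback (r : nat) (T U : finType) (H : rhypergraph r U)
    (f : T -> U) (x y : T) :
  (0 < r)%N -> link H (f x) = link H (f y) ->
  link (pullback H f) x = link (pullback H f) y.
Proof.
move=> r0; wlog suff: x y / link H (f x) = link H (f y) ->
  link (pullback H f) x \subset link (pullback H f) y.
  by move=> L xy; apply/eqP; rewrite eqEsubset !L.
move=> xy; apply/subsetP => A; rewrite !inE => /and3P[cA cxA].
rewrite imsetU1 cA /= => xA.
have fA : #|[set f z | z in A]| = r.-1.
  have le : (#|[set f z | z in A]| <= r.-1)%N by rewrite -(eqP cA) leq_imset_card.
  have := edge_card xA; rewrite cardsU1; case: (_ \notin _) => /= e; lia.
have yA : [set f z | z in A] \in link H (f y).
  by rewrite -xy inE fA eqxx.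
move: yA; rewrite inE => /andP[_ yA]; rewrite imsetU1 yA andbT cardsU1 (eqP cA).
have := edge_card yA; rewrite cardsU1 fA.
have [/(imset_f f) -> //= | _ _] := boolP (y \in A).
  by lia.
by apply/eqP; rewrite add1n prednK.
Qed.

(** * Symmetrization *)

Definition twins (r : nat) (T : finType) (H : rhypergraph r T) (x : T) : nat :=
  #|[set y | link H y == link H x]|.

Definition twin_pairs (r : nat) (T : finType) (H : rhypergraph r T) : nat :=
  (\sum_(x : T) twins H x)%N.

(** Pulling back along this map makes [v] a clone of [u] and leaves the edges avoiding [v]
    unchanged. *)
Definition redirect (T : finType) (u v x : T) : T := if x == v then u else x.

Lemma redirect_id (T : finType) (u v : T) (e : {set T}) :
  v \notin e -> [set redirect u v x | x in e] = e.
Proof.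
move=> ve; rewrite -[RHS]imset_id; apply: eq_in_imset => x xe.
by rewrite /redirect; case: eqP => // xv; rewrite -xv xe in ve.
Qed.

(** Edges avoiding [v] survive. Replacing [u] by [v] turns the edges through [u] injectively into
    edges of the pullback through [v], because no edge contains both. *)
Lemma card_symmetrize (r : nat) (T : finType) (H : rhypergraph r T) (u v : T) :
  (forall e : {set T}, e \in edges H -> ~~ ((u \in e) && (v \in e))) ->
  u != v ->
  (#|edges H| + degree H u
     <= #|edges (pullback H (redirect u v))| + degree H v)%N.
Proof.
move=> uv neq.
rewrite -(cardsID [set e : {set T} | v \in e] (edges H)).
rewrite -(cardsID [set e : {set T} | v \in e] (edges (pullback H _))).
have -> : edges H :&: [set e : {set T} | v \in e] = [set e in edges H | v \in e].
  by apply/setP => e; rewrite !inE.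
rewrite -/(degree H v).
suff [l1 l2] : (degree H u <= #|edges (pullback H (redirect u v))
      :&: [set e : {set T} | v \in e]|)%N /\
   (#|edges H :\: [set e : {set T} | v \in e]| <=
    #|edges (pullback H (redirect u v)) :\: [set e : {set T} | v \in e]|)%N
  by rewrite -addnA addnC leq_add2r addnC; exact: leq_add.
split; last first.
  apply: subset_leq_card; apply/subsetP => e; rewrite !inE => /andP[ve eH].
  by rewrite ve redirect_id // eH (edge_card eH) eqxx.
rewrite /degree -(@card_in_imset _ _ (fun e => v |: (e :\ u))
  [set e in edges H | _]); last first.
  move=> e d; rewrite !inE => /andP[eH ue] /andP[dH ud].
  have := uv e eH; have := uv d dH; rewrite ue ud /= => vd ve.
  have vU (c : {set T}) : v \notin c -> v \notin c :\ u.
    by rewrite !inE negb_and orbC => ->.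
  move=> /(congr1 (fun A => A :\ v)); rewrite !setU1K ?vU //.
  by move=> /(congr1 (fun A => u |: A)); rewrite !setD1K.
apply: subset_leq_card; apply/subsetP => _ /imsetP[e + ->].
rewrite !inE => /andP[eH ue]; have := uv e eH; rewrite ue /= => ve.
have ve' : v \notin e :\ u by rewrite !inE negb_and ve orbT.
rewrite eqxx /= andbT cardsU1 ve' imsetU1 redirect_id // /redirect eqxx setD1K //.
by rewrite eH andbT -(edge_card eH) (cardsD1 u e) ue.
Qed.

(** Vertices whose images have equal links are twins in the pullback, so counting pairs by their
    images gives a lower bound. Pairs avoiding [v] contribute the same as before; those involving
    [v] number [2 * twins H v - 1] before and [2 * twins H u + 1] after. *)
Lemma twin_pairs_symmetrize (r : nat) (T : finType) (H : rhypergraph r T)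
    (u v : T) :
  (0 < r)%N -> link H u <> link H v -> (twins H v <= twins H u)%N ->
  (twin_pairs H < twin_pairs (pullback H (redirect u v)))%N.
Proof.
move=> r0 uv le.
pose E x y : nat := link H y == link H x.
have twinsE G x : twins (G : rhypergraph r T) x
    = (\sum_(y : T) (link G y == link G x))%N.
  by rewrite /twins -sum1_card big_mkcond; apply: eq_bigr => y _; rewrite inE; case: eqP.
pose f := redirect u v.
have fn x : x != v -> f x = x by rewrite /f /redirect => /negbTE ->.
have fv : f v = u by rewrite /f /redirect eqxx.
apply: (@leq_trans (\sum_x \sum_y E (f x) (f y))%N); last first.
  apply: leq_sum => x _; rewrite twinsE; apply: leq_sum => y _.
  rewrite /E; case: eqP => // xy.
  by rewrite (link_pullback (f := redirect u v) r0 xy) eqxx.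
have split_sum (g : T -> T -> nat) : (\sum_x \sum_y g x y =
    g v v + \sum_(y | y != v) g v y + \sum_(x | x != v) g x v
      + \sum_(x | x != v) \sum_(y | y != v) g x y)%N.
  rewrite (bigD1 v) //= (bigD1 v) //= -[RHS]addnA; congr addn.
  by rewrite -big_split; apply: eq_bigr => x _; rewrite (bigD1 v).
have symE x y : E x y = E y x by rewrite /E eq_sym.
have -> : twin_pairs H = (\sum_x \sum_y E x y)%N.
  by apply: eq_bigr => x _; rewrite twinsE.
rewrite !split_sum fv.
have -> : (\sum_(x | x != v) \sum_(y | y != v) E (f x) (f y) =
           \sum_(x | x != v) \sum_(y | y != v) E x y)%N.
  by apply: eq_bigr => x xv; apply: eq_bigr => y yv; rewrite !fn.
have -> : (\sum_(y | y != v) E u (f y) = \sum_(y | y != v) E u y)%N.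
  by apply: eq_bigr => y yv; rewrite !fn.
have -> : (\sum_(y | y != v) E (f y) u = \sum_(y | y != v) E u y)%N.
  by apply: eq_bigr => y yv; rewrite !fn // symE.
have -> : (\sum_(y | y != v) E y v = \sum_(y | y != v) E v y)%N.
  by apply: eq_bigr => y yv; rewrite symE.
have tv : (twins H v = 1 + \sum_(y | y != v) E v y)%N.
  by rewrite twinsE (bigD1 v) //= eqxx.
have tu : (twins H u = \sum_(y | y != v) E u y)%N.
  by rewrite twinsE (bigD1 v) //=; case: eqP => // e; case: uv.
have E1 x : E x x = 1%N by rewrite /E eqxx.
rewrite !E1 ltn_add2r; lia.
Qed.

(** The lexicographic order by edges, then by twin pairs, coded as one number: [twin_pairs] never
    exceeds [#|T| ^ 2]. *)
Definition sym_weight (r : nat) (T : finType) (H : rhypergraph r T) : nat :=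
  (#|edges H| * (#|T| ^ 2).+1 + twin_pairs H)%N.

Lemma twin_pairs_leq (r : nat) (T : finType) (H : rhypergraph r T) :
  (twin_pairs H <= #|T| ^ 2)%N.
Proof.
apply: (@leq_trans (\sum_(x : T) #|T|)%N).
  by apply: leq_sum => x _; exact: max_card.
by rewrite sum_nat_const cardT.
Qed.

Lemma sym_weight_leq (r : nat) (T : finType) (H : rhypergraph r T) :
  (sym_weight H <= #|{set T}| * (#|T| ^ 2).+1 + #|T| ^ 2)%N.
Proof. by rewrite leq_add ?twin_pairs_leq // leq_mul2r max_card orbT. Qed.

Lemma symmetrization_step (r : nat) (T : finType) (H : rhypergraph r T) :
  (0 < r)%N -> ~ symmetrized H ->
  exists u v : T, let G := pullback H (redirect u v) in
    (#|edges H| <= #|edges G|)%N /\ (sym_weight H < sym_weight G)%N.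
Proof.
move=> r0 Hns.
have [u [v [uv nuv]]] : exists u v, link H u <> link H v /\
    forall e : {set T}, e \in edges H -> ~~ ((u \in e) && (v \in e)).
  apply: contra_notP Hns => Hns u v uv; apply: contrapT => nuv.
  apply: Hns; exists u, v; split=> // e eH; apply/negP => euv.
  by apply: nuv; exists e.
(* The situation is symmetric in [u] and [v], so [u] may be taken as the vertex to clone: a strict
   degree gain adds edges, and a tie adds twin pairs. *)
wlog le : u v uv nuv / (degree H v < degree H u)%N ||
    (degree H v == degree H u) && (twins H v <= twins H u)%N.
  move=> L; case: (ltngtP (degree H v) (degree H u)) => d.
  - by apply: (L u v) => //; rewrite d.
  - apply: (L v u); [by move=> /esym | | by rewrite d].
    by move=> e /nuv; rewrite andbC.
  - case: (leqP (twins H v) (twins H u)) => [t|/ltnW t].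
      by apply: (L u v) => //; rewrite d eqxx t orbT.
    apply: (L v u); [by move=> /esym | | by rewrite d eqxx t orbT].
    by move=> e /nuv; rewrite andbC.
have neq : u != v by apply/eqP => e; apply: uv; rewrite e.
exists u, v => /=; have := card_symmetrize nuv neq.
set G := pullback H _ => cG.
case/orP: le => [lt | /andP[/eqP eqd t]].
  have lt' : (#|edges H| < #|edges G|)%N.
    by rewrite -(ltn_add2r (degree H v)); apply: leq_trans cG; rewrite ltn_add2l.
  split; first exact: ltnW.
  rewrite /sym_weight; apply: (@leq_trans (#|edges H|.+1 * (#|T| ^ 2).+1)%N).
    by rewrite mulSn addnC ltn_add2r ltnS twin_pairs_leq.
  by apply: leq_trans (leq_addr _ _); rewrite leq_mul2r lt' orbT.
have le' : (#|edges H| <= #|edges G|)%N by move: cG; rewrite eqd leq_add2r.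
split=> //; rewrite /sym_weight -addnS leq_add ?leq_mul2r ?le' ?orbT //.
exact: twin_pairs_symmetrize.
Qed.

(** * Edge bounds from the Turan density *)

Lemma card_edges_turan (r : nat) (FF : rhypergraph_class r) (T : finType)
    (H : rhypergraph r T) :
  family_free FF H -> (#|edges H| <= turan_number #|T| FF)%N.
Proof.
move=> HF; pose G := pullback H (@enum_val T predT : 'I_#|T| -> T).
have GH : subgraph G H.
  exists enum_val; split; first exact: enum_val_inj.
  by move=> e; rewrite inE => /andP[].
apply: (@leq_trans #|edges G|); last first.
  apply: (@leq_bigmax_cond _ _ (fun G : rhypergraph r 'I_#|T| => #|edges G|)).
  by apply/asboolP; exact: family_free_subgraph GH HF.
rewrite -(card_imset _ (imset_inj (@enum_rank_inj T))).
apply: subset_leq_card; apply/subsetP => _ /imsetP[e eH ->].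
rewrite inE card_imset ?(edge_card eH) ?eqxx; last exact: enum_rank_inj.
rewrite -imset_comp (eq_imset _ (g := id)) ?imset_id // => x.
exact: enum_rankK.
Qed.

(* The junk value of [limn] on a divergent sequence is [0], so a positive
   density forces the defining limit to exist. *)
Lemma turan_density_bound (R : realType) (r : nat) (FF : rhypergraph_class r)
    (eta : R) :
  nondegenerate_family R FF -> 0 < eta ->
  exists N : nat, forall (T : finType) (H : rhypergraph r T),
    family_free FF H -> (N <= #|T|)%N ->
    #|edges H|%:R <= (turan_density R FF / r`!%:R + eta) * #|T|%:R ^+ r.
Proof.
rewrite /nondegenerate_family /turan_density.
set w := (fun n : nat => _) => w0 eta0.
have wcv : cvgn w.
  apply: contrapT => /dvgP e; move: w0; rewrite e.
  by rewrite (_ : point = 0) ?ltxx.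
have /(cvgr_le (limn w)) : (w @ \oo --> limn w)%classic by [].
move=> /(_ (limn w + eta)); rewrite ltrDl => /(_ eta0) [N _ NP].
(* With at least [r] vertices the binomial coefficient is positive and the quotient can be
   cleared. *)
exists (maxn N r) => T H HF; rewrite geq_max => /andP[NT rT].
have := NP #|T| NT; rewrite /= /w => wle.
have bin0 : 0 < 'C(#|T|, r)%:R :> R by rewrite ltr0n bin_gt0.
rewrite ler_pdivrMr // in wle.
have f0 : 0 < r`!%:R :> R by rewrite ltr0n fact_gt0.
apply: (@le_trans _ _ (turan_number #|T| FF)%:R).
  by rewrite ler_nat card_edges_turan.
apply: le_trans wle _.
apply: (@le_trans _ _ ((limn w + eta) * (#|T|%:R ^+ r / r`!%:R))).
  apply: ler_wpM2l; first by rewrite addr_ge0 // ltW.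
  rewrite ler_pdivlMr // -natrM bin_ffact -natrX ler_nat.
  exact: ffact_leq_exp.
rewrite mulrA mulrAC; apply: ler_wpM2r; first by rewrite exprn_ge0.
rewrite mulrDl lerD2l ler_pdivrMr //.
by apply: ler_peMr; [exact: ltW | rewrite ler1n fact_gt0].
Qed.

(** * Scarcity of low-degree vertices *)

(** In the induction step the cubic term is nonpositive, and [r ^ 2 + r <= (r + 1) ^ 2]. *)
Lemma expr_1B_leq (R : realType) (x : R) (r : nat) :
  0 <= x <= 1 -> (1 - x) ^+ r <= 1 - r%:R * x + r%:R ^+ 2 * x ^+ 2.
Proof.
move=> /andP[x0 x1]; elim: r => [|r IH]; first by rewrite expr0; lra.
rewrite exprS.
have x1' : 0 <= 1 - x by rewrite subr_ge0.
apply: le_trans (ler_wpM2l x1' IH) _.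
rewrite -[r.+1]addn1 natrD.
have r0 : 0 <= r%:R :> R by [].
have : 0 <= r%:R * x ^+ 2 by rewrite mulr_ge0 ?exprn_ge0.
have : 0 <= r%:R ^+ 2 * x ^+ 3 by rewrite mulr_ge0 ?exprn_ge0.
have : 0 <= x ^+ 2 by rewrite exprn_ge0.
nra.
Qed.

Definition low_degree (R : realType) (r : nat) (T : finType)
    (H : rhypergraph r T) (d : R) : {set T} :=
  [set v | (degree H v)%:R < d].

Lemma exists_subset_card (T : finType) (A : {set T}) (m : nat) :
  (m <= #|A|)%N -> exists2 B : {set T}, B \subset A & #|B| = m.
Proof.
case/card_geqP => s [us ss sA]; exists [set x in s].
  by apply/subsetP => x; rewrite inE => /sA.
by rewrite cardsE (card_uniqP us).
Qed.

(** Deleting [x * n] low vertices costs at most [x * (r * a - k) * n ^ r] edges, while the Turan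
    bound drops by about [x * r * a * n ^ r]. The surplus [k * x] would beat all error terms. *)
Lemma card_low_degree (R : realType) (r : nat) (FF : rhypergraph_class r)
    (a s : R) (N : nat) (T : finType) (H : rhypergraph r T) :
  (0 < r)%N -> 0 <= a -> 0 < s -> s <= 4^-1 ->
  (forall (U : finType) (G : rhypergraph r U), family_free FF G ->
     (N <= #|U|)%N -> #|edges G|%:R <= (a + s ^+ 2) * #|U|%:R ^+ r) ->
  family_free FF H -> (2 * N <= #|T|)%N -> 1 <= s * #|T|%:R ->
  (a - s ^+ 2) * #|T|%:R ^+ r <= #|edges H|%:R ->
  #|low_degree H ((r%:R * a - (2 * a * r%:R ^+ 2 + 3) * s) * #|T|%:R ^+ r.-1)|%:R
    <= 2 * s * #|T|%:R.
Proof.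
move=> r0 a0 s0 s4 turan HF NT sn Hbig.
set k := (2 * a * r%:R ^+ 2 + 3) * s; set n : R := #|T|%:R in sn Hbig *.
set Z := low_degree _ _; rewrite leNgt; apply/negP => Zbig.
have n0 : 0 < n by have : 0 <= n by []; nra.
(* Only about [s * n] low vertices are deleted: [s <= x <= 2 * s] keeps the quadratic error small
   and, as [s <= 4^-1], leaves at least half of the vertices. *)
pose m := (Num.truncn (s * n)).+1.
have mlo : s * n <= m%:R by rewrite ltW // truncnS_gt.
have mhi : m%:R <= 2 * s * n.
  have /truncn_itv/andP[t _] : 0 <= s * n by nra.
  rewrite /m -natr1; lra.
have [B BZ Bm] : exists2 B : {set T}, B \subset Z & #|B| = m.
  by apply: exists_subset_card; rewrite -(ler_nat R); apply: le_trans mhi (ltW Zbig).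
have mT : (m <= #|T|)%N by rewrite -Bm max_card.
pose x := m%:R / n.
have mx : m%:R = x * n by rewrite /x divfK // gt_eqF.
have xlo : s <= x by rewrite /x ler_pdivlMr.
have xhi : x <= 2 * s by rewrite /x ler_pdivrMr.
have cB : #|{: {x : T | x \in ~: B}}|%:R = (1 - x) * n.
  rewrite card_sig -Bm in mT *.
  rewrite (_ : #|_| = #|~: B|); last by apply: eq_card => y; rewrite !inE.
  by rewrite cardsCs setCK Bm natrB ?mx -?Bm ?max_card // -/n; ring.
have upper : #|edges (induced H (~: B))|%:R <= (a + s ^+ 2) * ((1 - x) * n) ^+ r.
  rewrite -cB; apply: turan.
    exact: family_free_subgraph (induced_subgraph _ _) HF.
  rewrite -(ler_nat R) cB; have : (2 * N)%:R <= n by rewrite ler_nat.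
  rewrite natrM; nra.
have low : (\sum_(w in B) degree H w)%:R
    <= m%:R * ((r%:R * a - k) * n ^+ r.-1).
  rewrite natr_sum -Bm -sumr_const mulr_suml; apply: ler_sum => w wB.
  by have := subsetP BZ w wB; rewrite inE mul1r => /ltW.
have : #|edges H|%:R <= (a + s ^+ 2) * ((1 - x) * n) ^+ r
    + m%:R * ((r%:R * a - k) * n ^+ r.-1).
  apply: le_trans (lerD upper low); rewrite -natrD ler_nat card_induced.
  by have := union_bound (edges H) (~: B); rewrite setCK.
move=> /(le_trans Hbig).
have nr : n ^+ r = n * n ^+ r.-1 by rewrite -exprS prednK.
rewrite exprMn mx (_ : x * n * _ = x * (r%:R * a - k) * n ^+ r); last first.
  by rewrite nr; ring.
rewrite mulrA -mulrDl ler_pM2r ?exprn_gt0 //.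
have q1 : (1 - x) ^+ r <= 1 by rewrite exprn_ile1; lra.
have /(expr_1B_leq r) q2 : 0 <= x <= 1 by lra.
have r2 : 0 <= a * r%:R ^+ 2 by rewrite mulr_ge0 ?exprn_ge0.
have aq : a * (1 - x) ^+ r <= a * (1 - r%:R * x + r%:R ^+ 2 * x ^+ 2).
  exact: ler_wpM2l.
have sq : s ^+ 2 * (1 - x) ^+ r <= s ^+ 2.
  by rewrite ler_piMr // exprn_ge0 ?ltW.
have ax : a * r%:R ^+ 2 * x * x <= a * r%:R ^+ 2 * x * (2 * s).
  by apply: ler_wpM2l => //; rewrite mulr_ge0 //; lra.
have sx : s * s <= s * x by rewrite ler_pM2l.
have ss : 0 < s * s by rewrite mulr_gt0.
(* In [k], the part [2 * a * r ^ 2] absorbs the quadratic term through [x <= 2 * s]. Two of the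
   three remaining [s * x] absorb the two errors [s ^ 2], and the third gives the strict
   contradiction. *)
rewrite /k; lra.
Qed.

(** * Putting vertices back *)

(** Induction on [#|B :\: A|], extending by one vertex each time. Restricting to [B] costs each
    degree at most [t * #|T| ^ r.-1], which the slack [zeta - k] covers. *)
Lemma sub_member_add_vertices (R : realType) (r : nat)
    (FF HH : rhypergraph_class r) (c k t zeta : R) (N : nat) (T : finType)
    (H : rhypergraph r T) (A B : {set T}) :
  (2 <= r)%N ->
  (forall (U : finType) (G : rhypergraph r U),
    family_free FF G -> (N <= #|U|)%N ->
    (c - zeta) * #|U|%:R ^+ r.-1 <= (min_degree G)%:R ->
    (exists v : U, sub_member HH (del_vertex G v)) -> sub_member HH G) ->
  family_free FF H -> A \subset B -> (N <= #|A|)%N ->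
  (forall v, v \in B -> (c - k) * #|T|%:R ^+ r.-1 <= (degree H v)%:R) ->
  #|~: A|%:R <= t * #|T|%:R -> k + t <= zeta ->
  sub_member HH (induced H A) -> sub_member HH (induced H B).
Proof.
move=> r2 ext HF AB NA degB cA kt HA.
have [m] := ubnP #|B :\: A|; elim: m B AB degB => // m IH B AB degB.
rewrite ltnS => cBA; have [BA | /subsetPn[v vB vA]] := boolP (B \subset A).
  by apply: sub_member_subgraph HA; exact: induced_sub.
have AC : A \subset B :\ v by rewrite subsetD1 AB vA.
have HC : sub_member HH (induced H (B :\ v)).
  apply: IH => //; first by move=> w; rewrite inE => /andP[_ /degB].
  apply: leq_trans cBA; rewrite (cardsD1 v (B :\: A)) !inE vA vB /= add1n ltnS.
  by apply: subset_leq_card; apply/subsetP => w; rewrite !inE => /and3P[-> -> ->].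
have cB : #|{: {x : T | x \in B}}| = #|B|.
  by rewrite card_sig; apply: eq_card => y; rewrite !inE.
apply: ext.
- exact: family_free_subgraph (induced_subgraph _ _) HF.
- by rewrite cB; apply: leq_trans NA (subset_leq_card AB).
- apply: (min_degree_geq (exist _ v vB)) => x.
  (* A negative threshold is met trivially; otherwise [#|B|] may be enlarged to [#|T|] in it. *)
  have [neg | pos] := ltP (c - zeta) 0.
    by apply: le_trans (ler0n _ _); rewrite mulr_le0_ge0 ?exprn_ge0 // ltW.
  apply: (@le_trans _ _ ((c - zeta) * #|T|%:R ^+ r.-1)).
    by apply: ler_wpM2l => //; rewrite cB lerXn2r ?nnegrE // ler_nat max_card.
  have := degree_induced_geq H x; rewrite -(ler_nat R) natrD natrM natrX.
  have := degB _ (valP x).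
  have : #|~: B|%:R * #|T|%:R ^+ (r - 2) <= t * #|T|%:R ^+ r.-1 :> R.
    have -> : r.-1 = (r - 2).+1 by lia.
    rewrite exprS mulrA; apply: ler_wpM2r; first exact: exprn_ge0.
    apply: le_trans cA; rewrite ler_nat subset_leq_card //.
    by rewrite setCS.
  have : 0 <= #|T|%:R ^+ r.-1 :> R by exact: exprn_ge0.
  have zkt : (c - zeta) * #|T|%:R ^+ r.-1 <= (c - k - t) * #|T|%:R ^+ r.-1.
    by apply: ler_wpM2r; [exact: exprn_ge0 | lra].
  move: zkt; rewrite [(c - k - t) * _]mulrBl; lra.
- exists (exist _ v vB).
  apply: sub_member_subgraph HC.
  exact: (del_vertex_induced H (exist _ v vB)).
Qed.

(** * Choice of constants and induction on the weight *)

Theorem theorem1p7 (R : realType) (r : nat) (FF HH : rhypergraph_class r) :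
  (2 <= r)%N ->
  blowup_invariant FF ->
  nondegenerate_family R FF ->
  iso_closed HH ->
  hereditary HH ->
  (forall (T : finType) (H : rhypergraph r T), HH T H -> family_free FF H) ->
  symmetrized_stable R FF HH ->
  vertex_extendable R FF HH ->
  degree_stable R FF HH.
Proof.
move=> r2 FFb FFnd _ _ _ [eps [N1 [eps0 sym]]] [zeta [N2 [zeta0 ext]]].
have r0 : (0 < r)%N by apply: ltnW.
set p := turan_density R FF in sym ext *.
pose a := p / r`!%:R.
have ca : p / r.-1`!%:R = r%:R * a.
  rewrite /a -[in r`!](prednK r0) factS prednK // natrM; field.
  by rewrite !pnatr_eq0 -!lt0n fact_gt0 r0.
have a0 : 0 < a by rewrite divr_gt0 // ltr0n fact_gt0.
pose K := 2 * a * r%:R ^+ 2 + 3.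
have K3 : 3 <= K.
  by rewrite /K lerDr mulr_ge0 ?exprn_ge0 // mulr_ge0 // ltW.
(* The bound by [eps] serves symmetrized stability. In the bound by [zeta], [K * s] is the degree
   slack and [5 * s] the share of vertices removed before extending. *)
have [s [s0 s4 seps szeta]] :
    exists s : R, [/\ 0 < s, s <= 10^-1, s ^+ 2 <= eps & (K + 5) * s <= zeta].
  exists (Num.min 10^-1 (Num.min eps (zeta / (K + 5)))); set s := Num.min _ _.
  have s0 : 0 < s by rewrite !lt_min eps0 divr_gt0 ?invr_gt0 //=; lra.
  have s10 : s <= 10^-1 by rewrite ge_min lexx.
  have se : s <= eps by rewrite !ge_min lexx orbT.
  split => //; first by rewrite expr2; nra.
  by rewrite mulrC -ler_pdivlMr ?ge_min ?lexx ?orbT //; lra.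
have s20 : 0 < s ^+ 2 by rewrite exprn_gt0.
have [N3 turan] := turan_density_bound FFnd s20.
(* The factors 2 allow for vertex sets shrunk to half; the last term ensures [1 <= s * #|T|]. *)
pose N := maxn (maxn N1 (2 * N3)) (maxn (2 * N2) (Num.truncn s^-1).+1).
pose Z (T : finType) (H : rhypergraph r T) :=
  low_degree H ((r%:R * a - K * s) * #|T|%:R ^+ r.-1).
have main (T : finType) (H : rhypergraph r T) : (N <= #|T|)%N ->
    family_free FF H -> (a - s ^+ 2) * #|T|%:R ^+ r <= #|edges H|%:R ->
    sub_member HH (induced H (~: Z T H)).
  rewrite !geq_max => /andP[/andP[nN1 nN3] /andP[nN2 ns]].
  have sn : 1 <= s * #|T|%:R.
    rewrite mulrC -ler_pdivrMr // div1r ltW //.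
    by apply: lt_le_trans (truncnS_gt _) _; rewrite ler_nat.
  have cZ G : family_free FF G ->
      (a - s ^+ 2) * #|T|%:R ^+ r <= #|edges (G : rhypergraph r T)|%:R ->
      #|Z T G|%:R <= 2 * s * #|T|%:R.
    by move=> GF Gbig; apply: (card_low_degree (FF := FF)) turan _ _ _ _ => //; [exact: ltW a0 | lra].
  (* Induction on the distance of the weight from its upper bound replaces the choice of a maximal
     counterexample. *)
  have [m] := ubnP (#|{set T}| * (#|T| ^ 2).+1 + #|T| ^ 2 - sym_weight H)%N.
  elim: m H => // m IH H; rewrite ltnS => mH HF Hbig.
  have [Hsym | Hns] := pselect (symmetrized H).
    apply: sub_member_subgraph (induced_subgraph _ _) _; apply: sym => //.
    by apply: le_trans Hbig; apply: ler_wpM2r; [exact: exprn_ge0 | rewrite lerD2l lerN2].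
  have [u [v]] := symmetrization_step r0 Hns.
  set G := pullback H _ => -[HG wHG].
  have GF : family_free FF G by exact: family_free_pullback.
  have Gbig : (a - s ^+ 2) * #|T|%:R ^+ r <= #|edges G|%:R.
    by apply: le_trans Hbig _; rewrite ler_nat.
  have GZ : sub_member HH (induced G (~: Z T G)).
    by apply: IH => //; have := sym_weight_leq G; lia.
  pose A := ~: (Z T H :|: Z T G :|: [set v]).
  (* Each low set has at most [2 * s * #|T|] vertices, and the single vertex [v] is paid for by
     [1 <= s * #|T|]. *)
  have cA : #|~: A|%:R <= 5 * s * #|T|%:R.
    rewrite setCK; have := cZ H HF Hbig; have := cZ G GF Gbig.
    have : (#|Z T H :|: Z T G :|: [set v]| <= #|Z T H| + #|Z T G| + 1)%N.
      rewrite -(cards1 v); apply: leq_trans (leq_card_setU _ _) _.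
      by rewrite leq_add2r leq_card_setU.
    rewrite -(ler_nat R) !natrD; lra.
  apply: (sub_member_add_vertices (A := A) r2 ext HF (k := K * s) (t := 5 * s)).
  - by rewrite setCS -setUA subsetUl.
  - rewrite -(ler_nat R).
    have : (2 * N2)%:R <= #|T|%:R :> R by rewrite ler_nat.
    have : #|T|%:R = #|A|%:R + #|~: A|%:R :> R by rewrite -natrD cardsC.
    have : 0 <= #|T|%:R :> R by [].
    rewrite natrM; nra.
  - by move=> w; rewrite !inE -leNgt ca.
  - exact: cA.
  - by rewrite -mulrDl.
  apply: sub_member_subgraph GZ; apply: induced_sub.
    by rewrite setCS -setUA setUCA subsetUl.
  move=> e eA eH; rewrite inE (edge_card eH) eqxx redirect_id //.
  by apply: contraTN eA => ve; apply/subsetPn; exists v; rewrite // !inE eqxx orbT.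
exists (s ^+ 2), N; split=> // T H HF NT dH.
have deg v : (r%:R * a - s ^+ 2) * #|T|%:R ^+ r.-1 <= (degree H v)%:R.
  by rewrite -ca; apply: le_trans dH _; rewrite ler_nat min_degree_leq.
(* No vertex is low, since [s ^ 2 <= K * s]. *)
have Z0 : ~: Z T H = setT.
  apply/setP => v; rewrite !inE -leNgt; apply: le_trans (deg v).
  by apply: ler_wpM2r; [exact: exprn_ge0 | rewrite lerD2l lerN2; nra].
have := main T H NT HF; rewrite Z0 => sub.
apply: (@sub_member_subgraph _ _ _ _ _ (induced H setT)).
  apply: (subgraph_induced (f := id)) => //.
  by move=> e; rewrite imset_id.
(* The edge bound follows from the degree sum: dividing by [r] only shrinks the error [s ^ 2]. *)
apply: sub; rewrite -(ler_pM2r (_ : 0 < r%:R)) ?ltr0n // -natrM -sum_degree natr_sum.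
apply: (@le_trans _ _ (\sum_(v : T) (r%:R * a - s ^+ 2) * #|T|%:R ^+ r.-1)).
  have nr : #|T|%:R ^+ r.-1 * #|T|%:R = #|T|%:R ^+ r :> R.
    by rewrite -exprSr prednK.
  rewrite sumr_const -[leRHS]mulr_natr -[leRHS]mulrA nr mulrAC.
  apply: ler_wpM2r; first exact: exprn_ge0.
  have : 1 <= r%:R :> R by rewrite ler1n.
  nra.
by apply: ler_sum => v _; exact: deg.
Qed.
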